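(* Let $\mathcal{B}\in\mathbb{C}^{\mathbf{I}(M)\times\mathbf{J}(N)}$ and $\mathcal{W}\in\mathbb{C}^{\mathbf{J}(N)\times\mathbf{I}(M)}$. Then for every positive integer $p$ there exists a unique tensor $\mathcal{X}\in\mathbb{C}^{\mathbf{I}(M)\times\mathbf{J}(N)}$ such that (a) $(\mathcal{B}*_N\mathcal{W})^{D}*_M\mathcal{X}*_N\mathcal{W}=[(\mathcal{B}*_N\mathcal{W})^{p}]^{D}$, (b) $\mathcal{B}*_N\mathcal{W}*_M\mathcal{X}=\mathcal{X}*_N\mathcal{W}*_M\mathcal{B}$, (c) $\mathcal{B}*_N\mathcal{W}*_M(\mathcal{B}*_N\mathcal{W})^{D}*_M\mathcal{X}=\mathcal{X}$. Further, $\mathcal{X}=\mathcal{B}*_N[(\mathcal{W}*_M\mathcal{B})^{p}]^{D}$.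
   Context: For positive integers $I_1,\dots,I_M$ write $\mathbf{I}(M)=I_1\times\cdots\times I_M$; $\mathbb{C}^{\mathbf{I}(M)\times\mathbf{J}(N)}$ is the set of complex tensors with entries $a_{i_1\dots i_M j_1\dots j_N}$, $1\le i_s\le I_s$, $1\le j_s\le J_s$. The Einstein product of $\mathcal{A}\in\mathbb{C}^{\mathbf{I}(M)\times\mathbf{K}(L)}$ and $\mathcal{B}\in\mathbb{C}^{\mathbf{K}(L)\times\mathbf{J}(N)}$ is $(\mathcal{A}*_L\mathcal{B})_{i_1\dots i_M j_1\dots j_N}=\sum_{k_1,\dots,k_L}a_{i_1\dots i_M k_1\dots k_L}b_{k_1\dots k_L j_1\dots j_N}$; similarly $\mathcal{A}*_L\mathcal{X}\in\mathbb{C}^{\mathbf{I}(M)}$ for $\mathcal{X}\in\mathbb{C}^{\mathbf{K}(L)}$. Powers of $\mathcal{A}\in\mathbb{C}^{\mathbf{I}(M)\times\mathbf{I}(M)}$ are taken with $*_M$, and $\mathcal{A}^0$ is the identity tensor. For such $\mathcal{A}$, the range is $\mathfrak{R}(\mathcal{A})=\{\mathcal{A}*_M\mathcal{X}:\mathcal{X}\in\mathbb{C}^{\mathbf{I}(M)}\}$, the index $\mathrm{ind}(\mathcal{A})$ is the smallest nonnegative integer $k$ with $\mathfrak{R}(\mathcal{A}^k)=\mathfrak{R}(\mathcal{A}^{k+1})$, and the Drazin inverse $\mathcal{A}^D$ is the (unique, always existing) $\mathcal{X}\in\mathbb{C}^{\mathbf{I}(M)\times\mathbf{I}(M)}$ with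 $\mathcal{A}^{k+1}*_M\mathcal{X}=\mathcal{A}^k$ (where $k=\mathrm{ind}(\mathcal{A})$), $\mathcal{X}*_M\mathcal{A}*_M\mathcal{X}=\mathcal{X}$, $\mathcal{A}*_M\mathcal{X}=\mathcal{X}*_M\mathcal{A}$. *)

(* Defs.v *)
From HB Require Import structures.
From mathcomp Require Import all_boot all_order all_algebra.
From mathcomp Require Import complex.
From mathcomp Require Import boolp classical_sets reals.
Set Implicit Arguments.
Unset Strict Implicit.
Unset Printing Implicit Defensive.
Import Order.TTheory GRing.Theory Num.Theory.
Local Open Scope classical_set_scope.
Local Open Scope ring_scope.

(* A shape d : 'I_M -> nat stands for the sizes I_1, ..., I_M; indices are
   0-based. *)
Definition mindex (M : nat) (d : 'I_M -> nat) : finType :=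
  {dffun forall s : 'I_M, 'I_(d s)}.

Definition vtensor (F : fieldType) (M : nat) (I : 'I_M -> nat) : choiceType :=
  {ffun mindex I -> F}.

Definition tensor (F : fieldType) (M N : nat) (I : 'I_M -> nat)
    (J : 'I_N -> nat) : choiceType :=
  {ffun mindex I * mindex J -> F}.

Section Einstein.
Variables (F : fieldType) (M L N : nat).
Variables (I : 'I_M -> nat) (K : 'I_L -> nat) (J : 'I_N -> nat).

Definition einprod (A : tensor F I K) (B : tensor F K J) : tensor F I J :=
  [ffun ij => \sum_(k : mindex K) A (ij.1, k) * B (k, ij.2)].

Definition einapp (A : tensor F I K) (X : vtensor F K) : vtensor F I :=
  [ffun i => \sum_(k : mindex K) A (i, k) * X k].

End Einstein.

Declare Scope tensor_scope.
Delimit Scope tensor_scope with T.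
Infix "*e" := einprod (at level 40, left associativity) : tensor_scope.
Local Open Scope tensor_scope.

Section Square.
Variables (F : fieldType) (M : nat) (I : 'I_M -> nat).
Implicit Types A X : tensor F I I.

Definition tid : tensor F I I := [ffun ij => (ij.1 == ij.2)%:R].

Definition texp A (k : nat) : tensor F I I := iter k (einprod A) tid.

Definition trange A : set (vtensor F I) := range (einapp A).

Definition range_stable A (k : nat) : Prop :=
  trange (texp A k) = trange (texp A k.+1).

(* Such a k always exists, because the ranges of the powers form a decreasing
   sequence of subspaces; the default value 0 of xget is never used. *)
Definition tindex A : nat :=
  xget 0%N [set k | range_stable A k /\
                    forall j : nat, range_stable A j -> (k <= j)%N].

Definition is_drazin A X : Prop :=
  [/\ texp A (tindex A).+1 *e X = texp A (tindex A),
      X *e A *e X = X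
    & A *e X = X *e A].

(* The Drazin inverse exists and is unique, so that the default value tid of
   xget is never used. *)
Definition drazin A : tensor F I I := xget tid [set X | is_drazin A X].

End Square.

(* Main.v *)
Require Import Defs.
From HB Require Import structures.
From mathcomp Require Import all_boot all_order all_algebra.
From mathcomp Require Import complex.
From mathcomp Require Import boolp classical_sets reals.
Set Implicit Arguments.
Unset Strict Implicit.
Unset Printing Implicit Defensive.
Import Order.TTheory GRing.Theory Num.Theory.
Local Open Scope ring_scope.
Local Open Scope tensor_scope.

(* Write A = B W and C = W B.  Cline's formula A^D = B (C^D)^2 W yields the
   intertwining relation A^D B = B C^D, from which X = B (C^D)^p satisfies (a),
   (b) and (c).  Conversely, (c), (b) and (a) give
   Y = A^D (A Y) = A^D Y W B = (A^p)^D B, so Y is unique.  The Drazin inverse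
   exists because, by Cayley-Hamilton, A^k = A^(k+1) r(A) for some polynomial
   r. *)

(* The exponent k only has to bound the index from above. *)
Definition drazin_at (S : pzRingType) (k : nat) (a x : S) : Prop :=
  [/\ a ^+ k.+1 * x = a ^+ k, x * a * x = x & a * x = x * a].

(** * Drazin inverses in an arbitrary ring *)

Section RingDrazin.
Variable S : pzRingType.
Implicit Types a x y z : S.

Lemma drazin_atD m k a x : drazin_at k a x -> drazin_at (m + k) a x.
Proof.
by case=> e1 e2 e3; split=> //; rewrite -addnS !exprD -mulrA e1.
Qed.

(** Since [a * x] is idempotent, it equals [(a * x) ^+ k.+1], which splits because [a] and [x]
    commute. *)
Lemma drazin_at_proj k a x : drazin_at k a x ->
  a * x = a ^+ k.+1 * x ^+ k.+1.
Proof.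
case=> _ e2 e3; rewrite -exprMn_comm // exprS.
have idem: a * x * (a * x) = a * x by rewrite mulrA -(mulrA a) -mulrA e2.
by elim: k => [|k IHk]; rewrite ?mulr1 // exprS mulrA idem.
Qed.

(** Once [a * x] is written with a factor [a ^+ k.+1], both equations reduce to
    [a ^+ k.+1 * (a * y) = a ^+ k.+1]. *)
Lemma drazin_at_absorb k a x y : drazin_at k a x -> drazin_at k a y ->
  a * x * (a * y) = a * x /\ a * y * (a * x) = a * x.
Proof.
move=> dx [f1 f2 f3]; have [_ _ e3] := dx.
have f4: a ^+ k.+1 * (a * y) = a ^+ k.+1.
  by rewrite mulrA -exprSr exprS -mulrA f1 -exprS.
have cay: GRing.comm (a * y) (a ^+ k.+1).
  by apply: commrX; rewrite /GRing.comm -mulrA -f3.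
have cax: a ^+ k.+1 * x ^+ k.+1 = x ^+ k.+1 * a ^+ k.+1.
  by apply: commrX; apply/commr_sym/commrX/commr_sym.
rewrite (drazin_at_proj dx); split; last by rewrite mulrA cay f4.
by rewrite cax -mulrA f4.
Qed.

(** Over a common bound, mutual absorption of the idempotents gives [a * x = a * y]; then x = xax =
    xay = axy = ayy = y. *)
Lemma drazin_at_unique k l a x y :
  drazin_at k a x -> drazin_at l a y -> x = y.
Proof.
move=> /(drazin_atD l) dx /(drazin_atD k); rewrite addnC => dy.
have [[_ e2 e3] [_ f2 f3]] := (dx, dy).
have exy: a * x = a * y.
  by have [<- _] := drazin_at_absorb dx dy; case: (drazin_at_absorb dy dx).
by rewrite -e2 -mulrA exy mulrA -e3 exy f3.
Qed.

Lemma expr_mul_stable k n a z : a ^+ k.+1 * z = a ^+ k ->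
  a ^+ (n + k) * z ^+ n = a ^+ k.
Proof.
move=> ez; elim: n => [|n IHn]; first by rewrite mulr1.
by rewrite exprS mulrA addSnnS exprD -(mulrA _ _ z) ez -exprD IHn.
Qed.

Lemma drazin_at_exists k a z : GRing.comm a z -> a ^+ k.+1 * z = a ^+ k ->
  exists x, drazin_at k a x.
Proof.
(* In this witness each factor [z] cancels one factor [a] in excess of [a ^+ k]. *)
move=> caz ez; exists (a ^+ k * z ^+ k.+1).
have ezn n := expr_mul_stable n ez.
have cak : GRing.comm a (z ^+ k.+1) by apply: commrX.
have cx : GRing.comm a (a ^+ k * z ^+ k.+1).
  by apply: commrM => //; apply: commrX.
split=> //; first by rewrite mulrA -exprD ezn.
rewrite -cx -mulrA.
have -> : a ^+ k * z ^+ k.+1 * (a ^+ k * z ^+ k.+1) =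
    a ^+ k * a ^+ k * z ^+ k.+1 * z ^+ k.+1.
  rewrite -!mulrA; congr (_ * _); rewrite !mulrA; congr (_ * _).
  by apply: commrX; apply: commr_sym.
by rewrite !mulrA -exprS -exprD ezn.
Qed.

(** This descends from a crude bound to the index itself. As [z] may fail to commute with [a], first
    [x] is moved to the left of [a ^+ j.+1]; then [a ^+ j] is expanded as
    [a ^+ (k + j) * z ^+ k]. *)
Lemma drazin_at_lower j k a x z : drazin_at k a x ->
  a ^+ j.+1 * z = a ^+ j -> drazin_at j a x.
Proof.
move=> [e1 e2 e3] /(expr_mul_stable k) ez; split=> //.
have cxaj : GRing.comm x (a ^+ j.+1) by apply: commrX; rewrite /GRing.comm e3.
have cxak : GRing.comm x (a ^+ k.+1) by apply: commrX; rewrite /GRing.comm e3.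
rewrite -cxaj exprS -[in LHS]ez exprD -!mulrA [a * _]mulrA -exprS mulrA.
by rewrite cxak e1 mulrA -exprD ez.
Qed.

Lemma drazin_atX k a x p : drazin_at k a x -> drazin_at k (a ^+ p) (x ^+ p).
Proof.
case=> e1 e2 e3.
have cxp : GRing.comm (x ^+ p) (a ^+ p).
  by apply: commrX; apply/commr_sym/commrX.
split=> //.
- have ek n := expr_mul_stable n e1.
  (* For positive exponents, [p.+1 * k = k + p * k] leaves a factor [a ^+ k] to absorb the powers of
     [x]; exponent 0 is trivial. *)
  rewrite -!exprM; case: p {cxp} => [|p]; first by rewrite !mul0n mulr1.
  by rewrite mulnS (mulSn p k) addnA addnC exprD -mulrA ek -exprD addnC.
- have cxap : GRing.comm (x * a) x by rewrite /GRing.comm -mulrA e3 mulrA.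
  by rewrite -!exprMn_comm // ?e2 //; apply/commr_sym.
Qed.

End RingDrazin.

(** * Existence for square matrices over a field *)

Lemma mx_drazin_exists (F : fieldType) (n : nat) (a : 'M[F]_n) :
  exists k x, drazin_at k a x.
Proof.
case: n a => [|n] a.
  by exists 0%N, 0; split; apply/matrixP; case.
(* The characteristic polynomial is q X^k with q(0) nonzero, and q = r X + q(0). Cayley-Hamilton
   gives q(0) a^k = - r(a) a^(k+1), and dividing by q(0) yields [r']. *)
have [k [q]] := multiplicity_XsubC (char_poly a) 0.
rewrite monic_neq0 ?char_poly_monic //= subr0 => q0 eq_char.
have /factor_theorem [r] : root (q - q.[0]%:P) 0.
  by rewrite /root !hornerE subrr.
rewrite subr0 => /eqP; rewrite subr_eq => /eqP eq_q.
have ha := Cayley_Hamilton a.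
pose r' := - (q.[0]^-1 *: r).
have [z z_comm z_eq] : exists2 z, GRing.comm a z & a ^+ k.+1 * z = a ^+ k.
  exists (horner_mx a r'); first by apply: comm_mx_horner.
  move: ha; rewrite eq_char rmorphM rmorphXn /= horner_mx_X {1}eq_q.
  rewrite rmorphD rmorphM /= horner_mx_X horner_mx_C mulrDl => /eqP.
  rewrite addr_eq0 => /eqP ha.
  have /comm_mx_sym caR : comm_mx (horner_mx a r) (a ^+ k.+1).
    by apply: comm_horner_mx; apply: commrX.
  rewrite rmorphN /= horner_mxZ mulrN -scalerAr -mulmxE caR mulmxE.
  rewrite exprS mulrA ha.
  by rewrite -mulmxE mul_scalar_mx scalerN opprK scalerA mulVf ?scale1r.
by exists k; apply: drazin_at_exists z_comm z_eq.
Qed.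

(** * Transfer between tensors and matrices *)

Section TensorMatrix.
Variable F : fieldType.

(** This unfolding flattens multi-indices by enumeration, so that Einstein products become matrix
    products. *)
Definition mx_of_tensor (M N : nat) (I : 'I_M -> nat) (J : 'I_N -> nat)
    (A : tensor F I J) : 'M[F]_(#|mindex I|, #|mindex J|) :=
  \matrix_(i, j) A (enum_val i, enum_val j).

Definition tensor_of_mx (M N : nat) (I : 'I_M -> nat) (J : 'I_N -> nat)
    (A : 'M[F]_(#|mindex I|, #|mindex J|)) : tensor F I J :=
  [ffun ij => A (enum_rank ij.1) (enum_rank ij.2)].

Section Rectangular.
Variables (M L N : nat).
Variables (I : 'I_M -> nat) (K : 'I_L -> nat) (J : 'I_N -> nat).

Lemma mx_of_tensorK : cancel (@mx_of_tensor M N I J) (@tensor_of_mx M N I J).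
Proof. by move=> A; apply/ffunP => -[i j]; rewrite ffunE mxE !enum_rankK. Qed.

Lemma tensor_of_mxK : cancel (@tensor_of_mx M N I J) (@mx_of_tensor M N I J).
Proof. by move=> A; apply/matrixP => i j; rewrite mxE ffunE !enum_valK. Qed.

Lemma mx_of_einprod (A : tensor F I K) (B : tensor F K J) :
  mx_of_tensor (A *e B) = mx_of_tensor A *m mx_of_tensor B.
Proof.
apply/matrixP => i j; rewrite !mxE ffunE big_enum_val.
by apply: eq_bigr => k _; rewrite !mxE.
Qed.

Lemma einapp_einprod (A : tensor F I K) (B : tensor F K J) (v : vtensor F J) :
  einapp (A *e B) v = einapp A (einapp B v).
Proof.
apply/ffunP => i; rewrite !ffunE.
under eq_bigr do rewrite ffunE mulr_suml.
rewrite exchange_big; apply: eq_bigr => k _ /=.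
by rewrite ffunE mulr_sumr; apply: eq_bigr => j _; rewrite mulrA.
Qed.

End Rectangular.

Section Square.
Variables (M : nat) (I : 'I_M -> nat).
Implicit Types A X : tensor F I I.

Lemma mx_of_texp A k : mx_of_tensor (texp A k) = mx_of_tensor A ^+ k.
Proof.
elim: k => [|k IHk]; last by rewrite /= mx_of_einprod IHk exprS.
by apply/matrixP => i j; rewrite !mxE ffunE (inj_eq enum_val_inj).
Qed.

(** Equality of ranges becomes solvability of one equation: the columns of [Z] are preimages of the
    columns of [texp A k]. *)
Lemma range_stableP A k :
  range_stable A k <-> exists Z, texp A k.+1 *e Z = texp A k.
Proof.
split=> [st|[Z eZ]].
  have /choice [f fE] (j : mindex I) : exists v : vtensor F I,
      einapp (texp A k.+1) v = [ffun i => texp A k (i, j)].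
    have [] : trange (texp A k.+1) [ffun i => texp A k (i, j)]; last first.
      by move=> v _ ev; exists v.
    (* Column [j] is the image of the [j]-th basis vector. *)
    rewrite -st; exists [ffun i => (i == j)%:R] => //.
    apply/ffunP => i; rewrite !ffunE (bigD1 j) //= ffunE eqxx mulr1.
    rewrite big1 ?addr0 // => l /negbTE nlj.
    by rewrite ffunE nlj mulr0.
  exists [ffun ij => f ij.2 ij.1]; apply/ffunP => -[i j].
  have /ffunP/(_ i) := fE j; rewrite !ffunE => <-.
  by apply: eq_bigr => l _; rewrite ffunE.
have eS : texp A k.+1 = texp A k *e A.
  by apply: (can_inj (@mx_of_tensorK _ _ _ _));
    rewrite mx_of_einprod !mx_of_texp exprSr.
apply/seteqP; split=> _ [v _ <-].
  by rewrite -eZ einapp_einprod; exists (einapp Z v).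
by rewrite eS einapp_einprod; exists (einapp A v).
Qed.

Lemma drazin_at_range_stable A k x :
  drazin_at k (mx_of_tensor A) x -> range_stable A k.
Proof.
case=> ex _ _; apply/range_stableP; exists (tensor_of_mx x).
apply: (can_inj (@mx_of_tensorK _ _ _ _)).
by rewrite mx_of_einprod tensor_of_mxK !mx_of_texp.
Qed.

(** The matrix result provides some stable exponent, and well-ordering a least one, so [xget] does
    not return its default. *)
Lemma tindex_stable A : range_stable A (tindex A).
Proof.
rewrite /tindex; case: xgetP => [k _ [] //|none].
have [k [x /drazin_at_range_stable st]] := mx_drazin_exists (mx_of_tensor A).
have ex : exists k, `[< range_stable A k >] by exists k; apply/asboolP.
case: (none (ex_minn ex)); case: ex_minnP => m /asboolP stm min_m.
by split=> // j stj; apply/min_m/asboolP.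
Qed.

Lemma is_drazinE A X : is_drazin A X <->
  drazin_at (tindex A) (mx_of_tensor A) (mx_of_tensor X).
Proof.
have inj := can_inj (@mx_of_tensorK _ _ I I).
split=> -[e1 e2 e3]; split.
- by rewrite -!mx_of_texp -e1 mx_of_einprod.
- by rewrite -[in RHS]e2 !mx_of_einprod.
- by move/(congr1 (@mx_of_tensor _ _ _ _)): e3; rewrite !mx_of_einprod.
- by apply: inj; rewrite mx_of_einprod !mx_of_texp.
- by apply: inj; rewrite !mx_of_einprod.
- by apply: inj; rewrite !mx_of_einprod.
Qed.

(** The exponent supplied by Cayley-Hamilton may exceed the index; stability of the range at
    [tindex A] allows lowering it. *)
Lemma drazinP A : is_drazin A (drazin A).
Proof.
apply: xgetPex.
have [k [x dx]] := mx_drazin_exists (mx_of_tensor A).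
have /range_stableP [Z eZ] := tindex_stable A.
exists (tensor_of_mx x); apply/is_drazinE; rewrite tensor_of_mxK.
apply: (drazin_at_lower (z := mx_of_tensor Z) dx).
by rewrite -!mx_of_texp -eZ mx_of_einprod.
Qed.

Lemma mx_of_drazin A k x :
  drazin_at k (mx_of_tensor A) x -> mx_of_tensor (drazin A) = x.
Proof. by have /is_drazinE dA := drazinP A; apply: drazin_at_unique dA. Qed.

(** Uniqueness across different bounds makes it possible to avoid computing the index of the
    power. *)
Lemma mx_of_drazin_texp A p :
  mx_of_tensor (drazin (texp A p)) = mx_of_tensor (drazin A) ^+ p.
Proof.
have /is_drazinE/(drazin_atX p) := drazinP A.
by rewrite -(mx_of_texp A) => /mx_of_drazin.
Qed.

End Square.
End TensorMatrix.

(** * Cline's formula and the weighted equations for rectangular matrices *)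

Section Cline.
Variables (F : fieldType) (m n : nat) (b : 'M[F]_(m, n)) (w : 'M[F]_(n, m)).

Lemma expr_mulmx_swap k : (b *m w) ^+ k *m b = b *m (w *m b) ^+ k.
Proof.
elim: k => [|k IHk]; first by rewrite mul1mx mulmx1.
by rewrite !exprS -!mulmxE -mulmxA IHk !mulmxA.
Qed.

(** The bound grows by one because (bw)^(k+1) = b (wb)^k w. *)
Lemma drazin_at_cline k c : drazin_at k (w *m b) c ->
  drazin_at k.+1 (b *m w) (b *m (c *m c) *m w).
Proof.
move=> [e1 e2 e3]; set C := w *m b in e1 e2 e3 *.
have e4 : C ^+ k.+2 * (c * c) = C ^+ k.
  by rewrite exprS -mulrA (mulrA _ c) e1 mulrA -exprS.
have e5 : c * c * (C * C) * (c * c) = c * c.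
  have e2' : c * (C * c) = c by rewrite mulrA.
  by rewrite -!mulrA (mulrA C c) e3 -(mulrA c C) !e2'.
rewrite /drazin_at -!mulmxE; split.
- rewrite 2!mulmxA expr_mulmx_swap -/C -(mulmxA b) mulmxE e4.
  by rewrite [in RHS]exprSr -mulmxE mulmxA expr_mulmx_swap.
- transitivity (b *m (c * c * (C * C) * (c * c)) *m w); last by rewrite e5.
  by rewrite -!mulmxE /C !mulmxA.
- transitivity (b *m (C * c * c) *m w); first by rewrite -!mulmxE /C !mulmxA.
  by rewrite e3 -mulrA e3 -!mulmxE /C !mulmxA.
Qed.

(** By uniqueness [a'] is Cline's b c^2 w, and c^2 (wb) = c. *)
Lemma drazin_at_intertwine k l a' c :
  drazin_at k (b *m w) a' -> drazin_at l (w *m b) c -> a' *m b = b *m c.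
Proof.
move=> da dc; rewrite (drazin_at_unique da (drazin_at_cline dc)).
case: dc => _ e2 e3; rewrite -[in RHS]e2 -mulrA e3 -!mulmxE.
by rewrite !mulmxA.
Qed.

Lemma weighted_drazin_unique k l p a' c :
    drazin_at k (b *m w) a' -> drazin_at l (w *m b) c -> (0 < p)%N ->
  unique (fun y : 'M[F]_(m, n) =>
    [/\ a' *m y *m w = a' ^+ p, b *m w *m y = y *m w *m b
      & b *m w *m a' *m y = y]) (b *m c ^+ p).
Proof.
(* A positive exponent provides a factor [a'] in the power, so that [a' * a] acts on it as the
   identity. *)
move=> da dc; case: p => // p _.
have a'b := drazin_at_intertwine da dc.
have a'bX q : a' ^+ q *m b = b *m c ^+ q.
  elim: q => [|q IHq]; first by rewrite mul1mx mulmx1.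
  by rewrite exprSr -mulmxE -mulmxA a'b mulmxA IHq -mulmxA mulmxE -exprSr.
have [_ a'aa' aa'] := da; set a := b *m w in a'aa' aa' *.
have aa'X : a * a' ^+ p.+1 = a' ^+ p.+1 * a by apply: commrX.
have aa'XK : a' * a * a' ^+ p.+1 = a' ^+ p.+1.
  by rewrite [a' ^+ _]exprS mulrA a'aa'.
rewrite -a'bX; split=> [|y [ya yb yc]].
  split.
  - by rewrite mulmxA -mulmxA -/a !mulmxE -mulrA -aa'X mulrA.
  - by rewrite mulmxA mulmxE aa'X -mulmxE /a !mulmxA.
  - by rewrite mulmxA !mulmxE aa' aa'XK.
by rewrite -ya -!mulmxA (mulmxA y) -yb mulmxA mulmxE -aa'.
Qed.

End Cline.

Theorem theorem4p4 (R : realType) (M N : nat)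
    (I : 'I_M -> nat) (J : 'I_N -> nat)
    (I_gt0 : forall s, (0 < I s)%N) (J_gt0 : forall s, (0 < J s)%N)
    (B : tensor R[i] I J) (W : tensor R[i] J I) (p : nat) (p_gt0 : (0 < p)%N) :
  exists X : tensor R[i] I J,
    unique (fun Y : tensor R[i] I J =>
      [/\ drazin (B *e W) *e Y *e W = drazin (texp (B *e W) p),
          B *e W *e Y = Y *e W *e B
        & B *e W *e drazin (B *e W) *e Y = Y]) X
    /\ X = B *e drazin (texp (W *e B) p).
Proof.
have /is_drazinE := drazinP (B *e W); have /is_drazinE := drazinP (W *e B).
rewrite !mx_of_einprod => dWB dBW.
have inj K L := can_inj (@mx_of_tensorK R[i] M K I L).
exists (B *e drazin (texp (W *e B) p)); split; last exact: erefl.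
(* The matrix statement is applied to the unfoldings of [B] and [W]; injectivity of the unfolding
   carries existence and uniqueness back to tensors. *)
have [[Xa Xb Xc] uniqX] := weighted_drazin_unique dBW dWB p_gt0.
split=> [|Y [/(congr1 (@mx_of_tensor _ _ _ _ _))]].
  split; apply: inj; rewrite !mx_of_einprod.
  - by rewrite !(mx_of_drazin_texp _ p).
  - by rewrite (mx_of_drazin_texp _ p).
  - by rewrite (mx_of_drazin_texp _ p).
rewrite !mx_of_einprod (mx_of_drazin_texp _ p) => Ya.
move=> /(congr1 (@mx_of_tensor _ _ _ _ _)); rewrite !mx_of_einprod => Yb.
move=> /(congr1 (@mx_of_tensor _ _ _ _ _)); rewrite !mx_of_einprod => Yc.
by apply: inj; rewrite mx_of_einprod (mx_of_drazin_texp _ p); apply: uniqX.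
Qed.
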